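(* Let $n\ge 3$ be an integer and let $H$ be any graph of order $n'\ge 2$. Then: (i) if $n\equiv 0\pmod 2$, then $\gamma_{\rm sp}(P_n\Box H)=\frac{nn'}{2}$; (ii) if $n\equiv 1\pmod 2$, then $\frac{nn'}{2}\le\gamma_{\rm sp}(P_n\Box H)\le\frac{(n+1)n'}{2}$; (iii) if $n\equiv 0\pmod 4$, then $\gamma_{\rm sp}(C_n\Box H)=\frac{nn'}{2}$; (iv) if $n\equiv 1,3\pmod 4$, then $\frac{nn'}{2}\le\gamma_{\rm sp}(C_n\Box H)\le\frac{(n+1)n'}{2}$; (v) if $n\equiv 2\pmod 4$, then $\frac{nn'}{2}\le\gamma_{\rm sp}(C_n\Box H)\le\frac{(n+2)n'}{2}$.
   Context: All graphs are finite, simple and undirected. $P_n$ and $C_n$ denote the path and the cycle on $n$ vertices. For a vertex $v$, $N(v)$ is its set of neighbours; for $D\subseteq V(G)$, $\overline{D}=V(G)\setminus D$. A set $D\subseteq V(G)$ is a super dominating set of $G$ if for every $u\in\overline{D}$ there exists $v\in D$ such that $N(v)\cap\overline{D}=\{u\}$; the super domination number $\gamma_{\rm sp}(G)$ is the minimum cardinality of a super dominating set of $G$. The Cartesian product $G\Box H$ has vertex set $V(G)\times V(H)$, with $(g,h)$ adjacent to $(g',h')$ iff either $g=g'$ and $hh'\in E(H)$, or $gg'\in E(G)$ and $h=h'$. *)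

(* Defs.v *)
From mathcomp Require Import all_boot all_order all_algebra.

Set Implicit Arguments.
Unset Strict Implicit.
Unset Printing Implicit Defensive.

Record sgraph := SGraph {
  vertex :> finType;
  adj : rel vertex;
  adj_sym : symmetric adj;
  adj_irrefl : irreflexive adj
}.

Section SuperDomination.
Variable G : sgraph.

Definition nbhd (v : G) : {set G} := [set w | adj v w].

Definition super_dominating (D : {set G}) : bool :=
  [forall u in ~: D, exists v in D, nbhd v :&: ~: D == [set u]].

Lemma super_dominatingP (D : {set G}) :
  reflect (forall u, u \notin D ->
             exists2 v, v \in D & nbhd v :&: ~: D = [set u])
          (super_dominating D).
Proof.
apply: (iffP forall_inP) => [sD u uD | sD u].
  have /exists_inP[v vD /eqP vE] : [exists v in D, nbhd v :&: ~: D == [set u]].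
    by apply: sD; rewrite inE.
  by exists v.
rewrite inE => /sD[v vD vE].
by apply/exists_inP; exists v => //; apply/eqP.
Qed.

Lemma super_dominatingT : super_dominating [set: G].
Proof. by apply/super_dominatingP => u; rewrite inE. Qed.

Definition gamma_sp : nat :=
  #|[arg min_(D < [set: G] | super_dominating D) #|D|]|.

Lemma gamma_sp_attained :
  exists2 D : {set G}, super_dominating D & #|D| = gamma_sp.
Proof.
rewrite /gamma_sp; case: (arg_minnP _ super_dominatingT) => D sD _.
by exists D.
Qed.

Lemma gamma_sp_min (D : {set G}) : super_dominating D -> gamma_sp <= #|D|.
Proof.
rewrite /gamma_sp; case: (arg_minnP _ super_dominatingT) => D0 _ minD0.
exact: minD0.
Qed.

End SuperDomination.

Section Path.
Variable n : nat.

Definition path_adj : rel 'I_n := fun i j => (i.+1 == j) || (j.+1 == i).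

Lemma path_adj_sym : symmetric path_adj.
Proof. by move=> i j; rewrite /path_adj orbC. Qed.

Lemma path_adj_irrefl : irreflexive path_adj.
Proof. by move=> i; rewrite /path_adj orbb gtn_eqF. Qed.

Definition path_graph : sgraph := SGraph path_adj_sym path_adj_irrefl.

End Path.

Section Cycle.
Variable n : nat.

(* [ordS] is the cyclic successor i.+1 %% n. The condition [i != j] only      *)
(* matters for n = 1, where [ordS] has a fixed point; this graph is the cycle *)
(* C_n only for 3 <= n.                                                       *)
Definition cycle_adj : rel 'I_n :=
  fun i j => (i != j) && ((ordS i == j) || (ordS j == i)).

Lemma cycle_adj_sym : symmetric cycle_adj.
Proof. by move=> i j; rewrite /cycle_adj orbC eq_sym. Qed.

Lemma cycle_adj_irrefl : irreflexive cycle_adj.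
Proof. by move=> i; rewrite /cycle_adj eqxx. Qed.

Definition cycle_graph : sgraph := SGraph cycle_adj_sym cycle_adj_irrefl.

End Cycle.

Section CartesianProduct.
Variables G H : sgraph.

Definition cart_adj : rel (G * H) := fun p q =>
  ((p.1 == q.1) && adj p.2 q.2) || (adj p.1 q.1 && (p.2 == q.2)).

Lemma cart_adj_sym : symmetric cart_adj.
Proof.
move=> p q; rewrite /cart_adj (eq_sym p.1) (eq_sym p.2).
by rewrite (adj_sym p.1) (adj_sym p.2).
Qed.

Lemma cart_adj_irrefl : irreflexive cart_adj.
Proof. by move=> p; rewrite /cart_adj !adj_irrefl andbF. Qed.

Definition cart_prod : sgraph := SGraph cart_adj_sym cart_adj_irrefl.

End CartesianProduct.

(* Main.v *)
(* Choosing for each vertex outside a super dominating set its private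
   dominator is an injection into the set, whence the lower bounds. If S is
   super dominating in G then so is S x H in the product of G and H, since the
   H-neighbours of a vertex of S x H stay in S x H; this leaves the
   construction of small super dominating sets of paths and cycles. Those omit
   the vertices congruent to 1 or 2 mod 4, with a correction at the last one:
   4k dominates 4k + 1 and 4k + 3 dominates 4k + 2. *)
Require Import Defs.
From mathcomp Require Import all_boot all_order all_algebra.
From mathcomp Require Import zify.

Set Implicit Arguments.
Unset Strict Implicit.
Unset Printing Implicit Defensive.

Import Order.TTheory GRing.Theory Num.Theory.
Local Open Scope ring_scope.

Lemma leq_card_super_dominating (G : sgraph) (D : {set G}) :
  super_dominating D -> (#|G| <= 2 * #|D|)%N.
Proof.
move=> /super_dominatingP sD.
(* The default [u] only makes [f] total: off [D] the pick always succeeds. *)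
pose f u := odflt u [pick v in D | nbhd v :&: ~: D == [set u]].
have fP u : u \in ~: D -> f u \in D /\ nbhd (f u) :&: ~: D = [set u].
  rewrite inE => /sD[v vD vE]; rewrite /f.
  case: pickP => [w /andP[wD /eqP wE] //| /(_ v)].
  by rewrite vD vE eqxx.
have f_inj : {in ~: D &, injective f}.
  move=> u w /fP[_ uE] /fP[_ wE] fuw; apply: set1_inj.
  by rewrite -uE -wE fuw.
rewrite mul2n -addnn -(cardsC D) leq_add2l -(card_in_imset f_inj).
by apply/subset_leq_card/subsetP => _ /imsetP[u /fP[fuD _] ->].
Qed.

Lemma super_dominating_cart (G H : sgraph) (S : {set G}) :
  super_dominating S ->
  super_dominating (G := cart_prod G H) (setX S [set: H]).
Proof.
move=> /super_dominatingP sS; apply/super_dominatingP => -[g h].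
rewrite !inE andbT => /sS[v vS vE].
exists (v, h); first by rewrite !inE vS.
apply/setP => -[g' h']; rewrite !inE andbT /= /cart_adj /= xpair_eqE.
move/setP/(_ g'): vE; rewrite !inE => <-.
(* For [g' = v] the point lies in the layer over [v], which is inside [S], so both sides are
   false. *)
have [<-|_] := eqVneq v g'; first by rewrite vS !andbF.
by rewrite /= (eq_sym h) andbAC.
Qed.

Lemma gamma_sp_cart_lower (G H : sgraph) :
  (#|G| * #|H| <= 2 * gamma_sp (cart_prod G H))%N.
Proof.
have [D sD <-] := gamma_sp_attained (cart_prod G H).
by rewrite -card_prod; apply: leq_card_super_dominating.
Qed.

Lemma gamma_sp_cart_upper (G H : sgraph) :
  (gamma_sp (cart_prod G H) <= gamma_sp G * #|H|)%N.
Proof.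
have [S sS <-] := gamma_sp_attained G.
rewrite -(cardsT H) -cardsX.
exact/gamma_sp_min/super_dominating_cart.
Qed.

(** Each full block of four contributes two; a remainder [r] contributes [r - 1], truncated at
    zero. *)
Lemma sum_mod4_12 (m : nat) :
  (\sum_(i < m) ((i %% 4 == 1) || (i %% 4 == 2)) = 2 * (m %/ 4) + (m %% 4).-1)%N.
Proof. by elim: m => [|m IH]; rewrite ?big_ord0 // big_ord_recr /= IH; lia. Qed.

Lemma card_set_ord_pred (n : nat) (P : pred nat) :
  #|[set i : 'I_n | P i]| = (\sum_(i < n) P i)%N.
Proof. by rewrite -sum1dep_card big_mkcond; apply: eq_bigr => i _; case: (P i). Qed.

(** Residue 1 is dominated from its left, so it may be last; residue 2 is dominated from its right
    and needs a successor. *)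
Definition path_omitted (n i : nat) : bool :=
  (i %% 4 == 1)%N || (i %% 4 == 2)%N && (i.+1 < n)%N.

(** The last vertex is always kept: it is adjacent to 0, whose only omitted neighbour has to be
    1. *)
Definition cycle_omitted (n i : nat) : bool :=
  ((i %% 4 == 1)%N || (i %% 4 == 2)%N) && (i.+1 < n)%N.

Lemma card_path_omitted (n : nat) :
  #|[set i : 'I_n | path_omitted n i]| = (n %/ 2)%N.
Proof.
rewrite card_set_ord_pred; case: n => [|m]; first by rewrite big_ord0.
rewrite big_ord_recr /=.
(* The bound holds automatically below the last index, so only the last term can deviate from the
   residue count. *)
under eq_bigr => i _ do rewrite /path_omitted ltnS ltn_ord andbT.
by rewrite sum_mod4_12 /path_omitted; lia.
Qed.

Lemma card_cycle_omitted (n : nat) :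
  #|[set i : 'I_n | cycle_omitted n i]| =
  (2 * (n.-1 %/ 4) + (n.-1 %% 4).-1)%N.
Proof.
rewrite card_set_ord_pred; case: n => [|m]; first by rewrite big_ord0.
rewrite big_ord_recr /=.
under eq_bigr => i _ do rewrite /cycle_omitted ltnS ltn_ord andbT.
by rewrite sum_mod4_12 /cycle_omitted ltnn andbF addn0.
Qed.

Lemma super_dominating_path (n : nat) :
  super_dominating (G := path_graph n) (~: [set i : 'I_n | path_omitted n i]).
Proof.
apply/super_dominatingP => u; rewrite setCK !inE negbK => uO.
have ltun := ltn_ord u.
(* Restated over natural numbers, the claim falls within the reach of [lia]. *)
suff [v vn [vO vE]] : exists2 v : nat, (v < n)%N & ~~ path_omitted n v /\
    forall w : nat, (w < n)%N ->
      ((v.+1 == w) || (w.+1 == v)) && path_omitted n w = (w == u :> nat).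
  exists (Ordinal vn); first by rewrite !inE.
  by apply/setP => w; rewrite !inE; apply: vE.
move: uO; rewrite /path_omitted => /orP[u1|/andP[u2 u_lt]].
  by exists u.-1; [lia | split=> [|w wn]; lia].
by exists u.+1; [lia | split=> [|w wn]; lia].
Qed.

(** Reduction modulo a variable [n] is not linear arithmetic; a case distinction on wrap-around
    is. *)
Lemma modn_succ (n i : nat) :
  (i < n)%N -> (i.+1 %% n = if i.+1 == n then 0 else i.+1)%N.
Proof.
move=> i_lt; case: eqP => [->|ne_n]; first exact: modnn.
by rewrite modn_small // ltn_neqAle i_lt andbT; apply/eqP.
Qed.

Lemma super_dominating_cycle (n : nat) :
  super_dominating (G := cycle_graph n) (~: [set i : 'I_n | cycle_omitted n i]).
Proof.
apply/super_dominatingP => u; rewrite setCK !inE negbK => uO.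
have ltun := ltn_ord u.
pose s i := (if i.+1 == n then 0 else i.+1)%N.
suff [v vn [vO vE]] : exists2 v : nat, (v < n)%N & ~~ cycle_omitted n v /\
    forall w : nat, (w < n)%N ->
      (v != w) && ((s v == w) || (s w == v)) && cycle_omitted n w
      = (w == u :> nat).
  exists (Ordinal vn); first by rewrite !inE.
  apply/setP => w; rewrite !inE -[RHS]vE //= /cycle_adj.
  by rewrite -!val_eqE /= !modn_succ.
move: uO; rewrite /cycle_omitted /s => /andP[/orP[u1|u2] u_lt].
  by exists u.-1; [lia | split=> [|w wn]; do ?case: ifP => ?; lia].
by exists u.+1; [lia | split=> [|w wn]; do ?case: ifP => ?; lia].
Qed.

Lemma gamma_sp_path_upper (n : nat) :
  (gamma_sp (path_graph n) <= n - n %/ 2)%N.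
Proof.
apply: leq_trans (gamma_sp_min (super_dominating_path n)) _.
by rewrite cardsCs setCK card_path_omitted card_ord.
Qed.

(** Twice the right-hand side is [n], [n + 1], [n + 2], [n + 1] for [n] congruent to 0, 1, 2, 3 mod
    4. *)
Lemma gamma_sp_cycle_upper (n : nat) :
  (gamma_sp (cycle_graph n) <= n - (2 * (n.-1 %/ 4) + (n.-1 %% 4).-1))%N.
Proof.
apply: leq_trans (gamma_sp_min (super_dominating_cycle n)) _.
by rewrite cardsCs setCK card_cycle_omitted card_ord.
Qed.

(** Here [s] stands for the super domination number of the path or cycle, and [k] bounds the excess
    of [2 * s] over [n]. *)
Lemma half_bounds (n m s g k : nat) :
  (n * m <= 2 * g)%N -> (g <= s * m)%N -> (2 * s <= n + k)%N ->
  n%:R * m%:R / 2 <= g%:R :> rat /\ g%:R <= (n%:R + k%:R) * m%:R / 2 :> rat.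
Proof.
move=> lo up s_le; split.
  by rewrite ler_pdivrMr ?ltr0n // -!natrM ler_nat (mulnC g).
rewrite ler_pdivlMr ?ltr0n // -natrD -!natrM ler_nat.
by have := leq_mul s_le (leqnn m); lia.
Qed.

Theorem theorem24 (n n' : nat) (H : sgraph)
  (n_ge3 : (3 <= n)%N) (orderH : #|H| = n') (n'_ge2 : (2 <= n')%N) :
  let gP : rat := (gamma_sp (cart_prod (path_graph n) H))%:R in
  let gC : rat := (gamma_sp (cart_prod (cycle_graph n) H))%:R in
  [/\ (n = 0 %[mod 2])%N ->
        gP = n%:R * n'%:R / 2,
      (n = 1 %[mod 2])%N ->
        n%:R * n'%:R / 2 <= gP <= (n%:R + 1) * n'%:R / 2,
      (n = 0 %[mod 4])%N ->
        gC = n%:R * n'%:R / 2,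
      (n = 1 %[mod 4])%N \/ (n = 3 %[mod 4])%N ->
        n%:R * n'%:R / 2 <= gC <= (n%:R + 1) * n'%:R / 2
    & (n = 2 %[mod 4])%N ->
        n%:R * n'%:R / 2 <= gC <= (n%:R + 2) * n'%:R / 2].
Proof.
move=> gP gC.
have loP := gamma_sp_cart_lower (path_graph n) H.
have upP := gamma_sp_cart_upper (path_graph n) H.
have loC := gamma_sp_cart_lower (cycle_graph n) H.
have upC := gamma_sp_cart_upper (cycle_graph n) H.
rewrite card_ord orderH in loP; rewrite orderH in upP.
rewrite card_ord orderH in loC; rewrite orderH in upC.
have sP := gamma_sp_path_upper n; have sC := gamma_sp_cycle_upper n.
have boundP k := half_bounds (k := k) loP upP.
have boundC k := half_bounds (k := k) loC upC.
split=> n_mod.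
(* With excess 0 the upper bound meets the lower one, which gives equality. *)
- have [|lo] := boundP 0; first by lia.
  by rewrite addr0 => up; apply/le_anti; rewrite up lo.
- by have [|-> ->] := boundP 1; first lia.
- have [|lo] := boundC 0; first by lia.
  by rewrite addr0 => up; apply/le_anti; rewrite up lo.
- by have [|-> ->] := boundC 1; first lia.
- by have [|-> ->] := boundC 2; first lia.
Qed.
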